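(* Let $c:\mathbb{R}^d\to\mathbb{R}^m$ be a function, and for each $\ell\in\{1,\dots,L\}$ let $v_{\cdot,\ell}\in\mathbb{R}^m$ be a deterministic vector and $y_\ell(x)=v_{\cdot,\ell}^\top c(x)$ for $x\in\mathbb{R}^d$. Let $X^{(1)},\dots,X^{(N)}$ and $Z^{(1)},\dots,Z^{(N)}$ be independent samples drawn from the distribution $\mu_X$ of the input vector $X$. Then for all $I\subseteq\{1,\dots,d\}$ and all $\ell\in\{1,\dots,L\}$, $$\widehat{S_I^{\mathrm{c}}}^{\mathrm{pf}}(y_\ell(X))=\frac{v_{\cdot,\ell}^\top\;\widehat{D_I^{\mathrm{c}}}^{\mathrm{pf}}(c(X))\;v_{\cdot,\ell}}{v_{\cdot,\ell}^\top\;\widehat{\mathrm{Cov}}^{\mathrm{pf}}(c(X))\;v_{\cdot,\ell}}$$ (whenever the denominator of the left-hand side is nonzero), where the left-hand side is the scalar pick-freeze estimator computed from the outputs $y_\ell$, and the matrices on the right-hand side are the vector-valued pick-freeze estimators computed from the outputs $c$, all using the same samples $X^{(k)},Z^{(k)}$.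
   Context: The input vector $X=(X_1,\dots,X_d)$ has independent components and law $\mu_X$; outputs are assumed square integrable with respect to $\mu_X$. For $I\subseteq\{1,\dots,d\}$, $(x_I,z_{\sim I})$ denotes the point of $\mathbb{R}^d$ whose coordinates in $I$ are those of $x$ and whose other coordinates are those of $z$. For a (scalar- or vector-valued) function $f$ on $\mathbb{R}^d$ put, for $k=1,\dots,N$, $$Y_{(k)}=f(X^{(k)}),\qquad Y_{(k)}^*=f(X_I^{(k)},Z_{\sim I}^{(k)}),\qquad \widehat{f_0}^{\mathrm{pf}}=\frac1N\sum_{k=1}^N\frac{Y_{(k)}+Y^*_{(k)}}{2}.$$ Scalar pick-freeze (Janon–Monod) estimator of the closed Sobol' index, for $f$ scalar-valued: $$\widehat{S_I^{\mathrm{c}}}^{\mathrm{pf}}(f(X))=\frac{\frac1N\sum_{k=1}^N Y_{(k)}Y^*_{(k)}-\big(\widehat{f_0}^{\mathrm{pf}}\big)^2}{\frac1N\sum_{k=1}^N\frac{Y_{(k)}^2+(Y^*_{(k)})^2}{2}-\big(\widehat{f_0}^{\mathrm{pf}}\big)^2}.$$ Vector-valued pick-freeze estimators (matrices), for $f$ with values in $\mathbb{R}^m$ (column vectors): $$\widehat{D_I^{\mathrm{c}}}^{\mathrm{pf}}(f(X))=\frac1N\sum_{k=1}^N Y_{(k)}(Y^*_{(k)})^\top-\widehat{f_0}^{\mathrm{pf}}\big(\widehat{f_0}^{\mathrm{pf}}\big)^\top,$$ $$\widehat{\mathrm{Cov}}^{\mathrm{pf}}(f(X))=\frac1N\sum_{k=1}^N\frac{Y_{(k)}Y_{(k)}^\top+Y^*_{(k)}(Y^*_{(k)})^\top}{2}-\widehat{f_0}^{\mathrm{pf}}\big(\widehat{f_0}^{\mathrm{pf}}\big)^\top.$$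 *)

(* Defs.v *)
From HB Require Import structures.
From mathcomp Require Export all_boot all_order all_algebra.
From mathcomp Require Export all_classical all_reals all_analysis.

Set Implicit Arguments.
Unset Strict Implicit.
Unset Printing Implicit Defensive.

Import Order.TTheory GRing.Theory Num.Theory.
Import numFieldNormedType.Exports.

Local Open Scope classical_set_scope.
Local Open Scope ring_scope.

Section independence.
Context {dO : measure_display} {Omega : measurableType dO} {R : realType}.
Context {dE : measure_display} {E : measurableType dE} {J : finType}.

Definition mutually_independent (P : probability Omega R)
    (W : J -> {RV P >-> E}) : Prop :=
  forall (K : {set J}) (A : J -> set E),
    (forall j, j \in K -> measurable (A j)) ->
    P (\bigcap_(j in [set` K]) (W j @^-1` A j)) =
    (\prod_(j in K) P (W j @^-1` A j))%E.

End independence.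

(* Points of R^d are [d.-tuple R], because tuples carry the product
   sigma-algebra. *)
Section components.
Context {dO : measure_display} {Omega : measurableType dO} {R : realType}.
Context {d : nat}.

Definition component (P : probability Omega R) (X : {RV P >-> d.-tuple R})
    (i : 'I_d) : Omega -> R := fun w => tnth (X w) i.

Lemma measurable_component (P : probability Omega R)
    (X : {RV P >-> d.-tuple R}) (i : 'I_d) :
  measurable_fun [set: Omega] (component X i).
Proof.
exact: (measurableT_comp (measurable_tnth i) (measurable_funPT X)).
Qed.

HB.instance Definition _ (P : probability Omega R)
    (X : {RV P >-> d.-tuple R}) (i : 'I_d) :=
  isMeasurableFun.Build _ _ _ _ (component X i) (measurable_component X i).

Definition independent_components (P : probability Omega R)
    (X : {RV P >-> d.-tuple R}) : Prop :=
  mutually_independent (fun i : 'I_d => component X i : {RV P >-> R}).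

End components.

Section samples.
Context {dO : measure_display} {Omega : measurableType dO} {R : realType}.
Context {dE : measure_display} {E : measurableType dE} {N : nat}.

Definition join_samples (P : probability Omega R)
    (X Z : 'I_N -> {RV P >-> E}) (s : 'I_N + 'I_N) : {RV P >-> E} :=
  match s with inl k => X k | inr k => Z k end.

Definition independent_samples_of (mu : probability E R)
    (P : probability Omega R) (X Z : 'I_N -> {RV P >-> E}) : Prop :=
  mutually_independent (join_samples X Z) /\
  forall (s : 'I_N + 'I_N) (A : set E), measurable A ->
    distribution P (join_samples X Z s) A = mu A.

End samples.

(* The point (x_I, z_{~I}). *)
Definition freeze (R : realType) (d : nat) (I : {set 'I_d})
    (x z : d.-tuple R) : d.-tuple R :=
  [tuple if i \in I then tnth x i else tnth z i | i < d].

(* The estimators below are functions of the realized samples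
   [x k = X^(k)(w)] and [z k = Z^(k)(w)]. *)
Section scalar_estimators.
Context {R : realType} {d N : nat}.
Variables (f : d.-tuple R -> R) (I : {set 'I_d}) (x z : 'I_N -> d.-tuple R).

Let Y k := f (x k).
Let Ys k := f (freeze I (x k) (z k)).

Definition pf_mean : R := N%:R^-1 * \sum_(k < N) (Y k + Ys k) / 2.

(* Janon-Monod normalization: [pf_sobol] is the pick-freeze estimator of the
   closed Sobol' index of [I]. *)
Definition pf_sobol_num : R :=
  N%:R^-1 * \sum_(k < N) Y k * Ys k - pf_mean ^+ 2.

Definition pf_sobol_den : R :=
  N%:R^-1 * \sum_(k < N) (Y k ^+ 2 + Ys k ^+ 2) / 2 - pf_mean ^+ 2.

Definition pf_sobol : R := pf_sobol_num / pf_sobol_den.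

End scalar_estimators.

Section vector_estimators.
Context {R : realType} {d m N : nat}.
Variables (f : d.-tuple R -> 'cV[R]_m) (I : {set 'I_d}).
Variables (x z : 'I_N -> d.-tuple R).

Let Y k := f (x k).
Let Ys k := f (freeze I (x k) (z k)).

Definition pf_mean_vec : 'cV[R]_m :=
  N%:R^-1 *: \sum_(k < N) 2^-1 *: (Y k + Ys k).

Definition pf_D : 'M[R]_m :=
  N%:R^-1 *: \sum_(k < N) (Y k *m (Ys k)^T) - pf_mean_vec *m pf_mean_vec^T.

Definition pf_Cov : 'M[R]_m :=
  N%:R^-1 *: \sum_(k < N) 2^-1 *: (Y k *m (Y k)^T + Ys k *m (Ys k)^T)
  - pf_mean_vec *m pf_mean_vec^T.

End vector_estimators.

(* Main.v *)
(** The identity holds sample by sample: for [u = col l v], the matrix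
    estimators are combinations of rank-one matrices [a *m b^T], and
    [u^T (a b^T) u = (u^T a) (u^T b)] turns them into the scalar numerator
    and denominator computed from [y_l = u^T c]. *)
Require Import Defs.

Set Implicit Arguments.
Unset Strict Implicit.
Unset Printing Implicit Defensive.

Import Order.TTheory GRing.Theory Num.Theory.
Import numFieldNormedType.Exports.

Local Open Scope classical_set_scope.
Local Open Scope ring_scope.

Section quadratic_form.
Context {R : comPzRingType} {m : nat} (u : 'cV[R]_m).

Definition qform (M : 'M[R]_m) : R := (u^T *m M *m u) ord0 ord0.

Lemma qform_rank1 (a b : 'cV[R]_m) :
  qform (a *m b^T) = (u^T *m a) ord0 ord0 * (u^T *m b) ord0 ord0.
Proof.
(* A 1x1 matrix equals its transpose, and commutativity of [R] gives [(b^T *m u)^T = u^T *m b]. *)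
have -> : (u^T *m b) ord0 ord0 = (b^T *m u) ord0 ord0.
  by rewrite -[u in RHS]trmxK -trmx_mul [RHS]mxE.
(* Rebracketed as [(u^T *m a) *m (b^T *m u)], the product has inner dimension 1, so its sum is a
   single term. *)
by rewrite /qform mulmxA -mulmxA mxE big_ord1.
Qed.

Lemma qformD (A B : 'M[R]_m) : qform (A + B) = qform A + qform B.
Proof. by rewrite /qform mulmxDr mulmxDl mxE. Qed.

Lemma qformB (A B : 'M[R]_m) : qform (A - B) = qform A - qform B.
Proof. by rewrite /qform mulmxBr mulmxBl !mxE. Qed.

Lemma qformZ (t : R) (A : 'M[R]_m) : qform (t *: A) = t * qform A.
Proof. by rewrite /qform -scalemxAr -scalemxAl mxE. Qed.

Lemma qform_sum (N : nat) (A : 'I_N -> 'M[R]_m) :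
  qform (\sum_k A k) = \sum_k qform (A k).
Proof. by rewrite /qform mulmx_sumr mulmx_suml summxE. Qed.

End quadratic_form.

Section projected_estimators.
Context {R : realType} {d m N : nat}.
Variables (c : d.-tuple R -> 'cV[R]_m) (u : 'cV[R]_m) (f : d.-tuple R -> R).
Hypothesis fE : forall x, f x = (u^T *m c x) ord0 ord0.
Variables (I : {set 'I_d}) (x z : 'I_N -> d.-tuple R).

(** Left multiplication by [u^T] is linear, hence commutes with averaging. This handles the mean
    correction common to [pf_D] and [pf_Cov]. *)
Lemma pf_mean_proj : (u^T *m pf_mean_vec c I x z) ord0 ord0 = pf_mean f I x z.
Proof.
rewrite -scalemxAr mxE mulmx_sumr summxE; congr (_ * _).
by apply: eq_bigr => k _; rewrite -scalemxAr mxE mulmxDr mxE -!fE mulrC.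
Qed.

Lemma pf_sobol_num_qform : qform u (pf_D c I x z) = pf_sobol_num f I x z.
Proof.
(* Here [qform_rank1] reaches only the mean term; the summands are under a binder and follow
   next. *)
rewrite qformB qformZ qform_sum qform_rank1 pf_mean_proj -expr2.
by under eq_bigr do rewrite qform_rank1 -!fE.
Qed.

Lemma pf_sobol_den_qform : qform u (pf_Cov c I x z) = pf_sobol_den f I x z.
Proof.
rewrite qformB qformZ qform_sum qform_rank1 pf_mean_proj -expr2.
(* The final [mulrC] turns the scaling by [2^-1] into the division by 2 of the scalar estimator. *)
by under eq_bigr do
  rewrite qformZ qformD !qform_rank1 -!fE -!expr2 mulrC.
Qed.

End projected_estimators.

Theorem proposition2 (R : realType) (dO : measure_display)
    (Omega : measurableType dO) (P : probability Omega R)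
    (d m L N : nat)
    (X : {RV P >-> d.-tuple R}) (X_indep : independent_components X)
    (c : d.-tuple R -> 'cV[R]_m)
    (c_L2 : forall j : 'I_m,
      (fun x => c x j ord0) \in Lfun (distribution P X) 2%:E)
    (v : 'M[R]_(m, L))
    (y : 'I_L -> d.-tuple R -> R)
    (yE : forall l x, y l x = ((col l v)^T *m c x) ord0 ord0)
    (Xs Zs : 'I_N -> {RV P >-> d.-tuple R})
    (XZ_samples : independent_samples_of (distribution P X) Xs Zs)
    (I : {set 'I_d}) (l : 'I_L) (w : Omega) :
  let x := fun k => Xs k w in
  let z := fun k => Zs k w in
  pf_sobol_den (y l) I x z != 0 ->
  ((col l v)^T *m pf_Cov c I x z *m col l v) ord0 ord0 != 0 /\
  pf_sobol (y l) I x z =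
    ((col l v)^T *m pf_D c I x z *m col l v) ord0 ord0 /
    ((col l v)^T *m pf_Cov c I x z *m col l v) ord0 ord0.
Proof.
(* Rewritten this way, the hypothesis is the first conjunct up to unfolding [qform]. *)
move=> x z; rewrite -(pf_sobol_den_qform (yE l)) => den_neq0; split=> //.
by rewrite /pf_sobol -(pf_sobol_num_qform (yE l)) -(pf_sobol_den_qform (yE l)).
Qed.
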